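(* Let $E_n(x,y)$ be the Andr\'e polynomials. For $n\ge1$, $$E_{n+1}(x,y)=\sum_{T\in\mathrm{SYT}(n;2)}\left(\prod_{i=1}^n\sigma_i(T)\right)x^{n+1-w_1(T)-w_2(T)}y^{w_1(T)},$$ where $w_i(T)$ is the number of rows in $T$ with $i$ elements and $\sigma_i(T)$ is the box sorting index of $i$.
   Context: An increasing tree on $[m]$ is a rooted (non-plane) tree with vertex set $\{0,1,\dots,m\}$ in which labels increase along any path from the root $0$. The degree of a vertex is the number of its children. A 0-1-2 increasing tree is an increasing tree in which every vertex has degree at most two. Let $\mathcal E_n$ be the set of 0-1-2 increasing trees on $[n-1]$ (vertex set $\{0,\dots,n-1\}$). The Andr\'e polynomials are $E_n(x,y)=\sum_{T\in\mathcal E_n}x^{\ell(T)}y^{u(T)}$, where $\ell(T)$ is the number of leaves (vertices with no children) and $u(T)$ the number of vertices of degree $1$. E.g. $E_1=x$, $E_2=xy$, $E_3=xy^2+x^2$, $E_4=xy^3+4x^2y$. A standard Young tableau of size $n$ is a filling of the Ferrers diagram of a partition $\lambda\vdash n$ (French convention: left-justified rows numbered from bottom to top, $\lambda_i$ boxes in row $i$) with $1,\dots,n$, each used exactly once, increasing from left to right in rows and from bottom to top in columns; $\mathrm{SYT}(n)$ is the set of all of them, and $\mathrm{SYT}(n;k)$ is the subset of those with at most $k$ columns. For $T\in\mathrm{SYT}(n)$, $T_i$ is the tableau obtained from $T$ by deleting the entries $i+1,\dots,n$, and $\mathrm{col}_k(T_i)$ is the number of boxes in the $k$-th column of $T_i$.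 The box sorting index of $i$ is $$\sigma_i(T)=\begin{cases} i-\mathrm{col}_1(T_i)+1, & \text{if } i \text{ is in the first column of } T,\\ \mathrm{col}_k(T_i)-\mathrm{col}_{k+1}(T_i)+1, & \text{if } i \text{ is in the } (k+1)\text{-th column of } T,\ k\ge1.\end{cases}$$ *)

(* Defs.v *)
(* MathComp world; boolp is used only to form finite sets from Prop-valued
   predicates. *)
From mathcomp Require Import all_boot all_algebra.
From mathcomp Require Import boolp.
From mathcomp Require Import mpoly.

Set Implicit Arguments.
Unset Strict Implicit.
Unset Printing Implicit Defensive.

Import GRing.Theory.

Local Open Scope nat_scope.

(* A rooted tree on the vertex set {0, ..., m} is given by its set of
   (parent, child) pairs. *)
Definition digraph (m : nat) := {set 'I_m.+1 * 'I_m.+1}.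

Definition edge m (T : digraph m) : rel 'I_m.+1 := fun u v => (u, v) \in T.

(* From the root there is exactly one directed path to each vertex; the path
   is represented by the sequence p of its vertices after the root. *)
Definition rooted_tree m (T : digraph m) : Prop :=
  forall v : 'I_m.+1,
    exists! p : seq 'I_m.+1, path (edge T) ord0 p /\ last ord0 p = v.

Definition increasing_tree m (T : digraph m) : Prop :=
  rooted_tree T /\
  (forall p : seq 'I_m.+1, path (edge T) ord0 p ->
     path (fun u v : 'I_m.+1 => u < v) ord0 p).

Definition children m (T : digraph m) (u : 'I_m.+1) : {set 'I_m.+1} :=
  [set v | edge T u v].

Definition degree m (T : digraph m) (u : 'I_m.+1) : nat := #|children T u|.

Definition trees012 (m : nat) : {set digraph m} :=
  [set T | `[< increasing_tree T /\ (forall u, degree T u <= 2) >]].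

Definition leaves m (T : digraph m) : nat := #|[set u | degree T u == 0]|.

Definition unary m (T : digraph m) : nat := #|[set u | degree T u == 1]|.

Definition varx : {mpoly int[2]} := mpolyX int U_(@ord0 1)%MM.
Definition vary : {mpoly int[2]} := mpolyX int U_(@ord_max 1)%MM.

(* Meaningful for n >= 1 only: the vertex set is {0, ..., n - 1}. *)
Definition andre_poly (n : nat) : {mpoly int[2]} :=
  (\sum_(T in trees012 n.-1) varx ^+ leaves T * vary ^+ unary T)%R.

Definition is_partition (n : nat) (la : seq nat) : Prop :=
  [/\ sorted geq la, all (leq 1) la & sumn la = n].

(* A partition of n has at most n parts, each at most n, so its diagram fits in
   an n x n grid. T (r, c) is the entry of the box in row r (counted from the
   bottom) and column c (counted from the left), both starting at 0;
   T (r, c) = 0 means that the grid position (r, c) holds no box. *)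
Definition filling (n : nat) := {ffun 'I_n * 'I_n -> 'I_n.+1}.

Definition in_diagram (n : nat) (la : seq nat) (b : 'I_n * 'I_n) : bool :=
  b.2 < nth 0 la b.1.

Definition is_SYT n (T : filling n) : Prop :=
  exists la : seq nat,
    is_partition n la /\
    [/\ forall b, (T b != 0 :> nat) = in_diagram la b,
        forall k : nat, 1 <= k <= n -> exists! b, T b = k :> nat,
        forall r c c' : 'I_n,
          in_diagram la (r, c) -> in_diagram la (r, c') -> c < c' ->
          T (r, c) < T (r, c') &
        forall r r' c : 'I_n,
          in_diagram la (r, c) -> in_diagram la (r', c) -> r < r' ->
          T (r, c) < T (r', c)].

Definition ncols n (T : filling n) : nat :=
  #|[set c : 'I_n | [exists r : 'I_n, T (r, c) != 0 :> nat]]|.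

Definition SYT (n : nat) : {set filling n} := [set T | `[< is_SYT T >]].

Definition SYT_cols (n k : nat) : {set filling n} :=
  [set T in SYT n | ncols T <= k].

Definition restrict n (T : filling n) (i : nat) : filling n :=
  [ffun b => if T b <= i then T b else ord0].

(* The k-th column, with k starting at 1, is the one of grid index k - 1. *)
Definition col_size n (k : nat) (T : filling n) : nat :=
  #|[set b : 'I_n * 'I_n | (b.2.+1 == k) && (T b != 0 :> nat)]|.

(* The entry i lies in column number b.2 + 1. When T is a standard Young
   tableau and 1 <= i <= n, the box b exists and is unique, and the subtractions
   are not truncated; the value in the case None is then irrelevant. *)
Definition sigma n (i : nat) (T : filling n) : nat :=
  if [pick b : 'I_n * 'I_n | T b == i :> nat] is Some b then
    if b.2 == 0 :> nat then i - col_size 1 (restrict T i) + 1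
    else col_size b.2 (restrict T i) - col_size b.2.+1 (restrict T i) + 1
  else 0.

(* Used for i >= 1 only: for i = 0 it counts empty rows of the grid. *)
Definition nrows n (i : nat) (T : filling n) : nat :=
  #|[set r : 'I_n | #|[set c : 'I_n | T (r, c) != 0 :> nat]| == i]|.

(* Main.v *)
Require Import Defs.
From mathcomp Require Import all_boot all_algebra.
From mathcomp Require Import boolp zify.
From mathcomp Require Import mpoly.

Set Implicit Arguments.
Unset Strict Implicit.
Unset Printing Implicit Defensive.

Import GRing.Theory.

Local Open Scope nat_scope.

(** Increasing 0-1-2 trees and standard Young tableaux with at most two columns
    can both be built one label at a time, and the two constructions follow the
    same weighted recursion.

    Adding a largest vertex to a 0-1-2 increasing tree with l leaves and u
    unary vertices means choosing its parent. Each of the l leaves gives a tree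
    with the same number of leaves and one more unary vertex; each of the u
    unary vertices gives one more leaf and one less unary vertex. A vertex with
    two children cannot be chosen. The operator [grow] records this, and after
    m insertions the generating function is the m-th iterate of [grow],
    evaluated at the one-vertex tree, where l = 1 and u = 0
    ([sum_trees012]).

    A two-column tableau is the same thing as its ballot word: the i-th letter
    tells in which column i lies, and the conditions on rows and shape say that
    no prefix has more entries in the second column than in the first one. If
    the columns of the tableau have sizes a and b, with b <= a, then a new
    entry in the first column has box sorting index b + 1, and a new entry in
    the second one has index (a - (b + 1)) + 1 = a - b. Under the dictionary
    l = b + 1 and u = a - b, these are exactly the multiplicities l and u in
    [grow], and the moves on (l, u) agree too: enlarging the first column
    raises u by one, and enlarging the second one raises l and lowers u. Hence
    the sum over ballot words of the product of these weights is the same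
    iterate of [grow] ([sum_ballots]). Finally w_2 = b and w_1 = a - b, so that
    n + 1 - w_1 - w_2 = b + 1 = l and the monomials coincide.

    Most of the work is in matching the set-theoretic objects with the words
    that encode them: [trees012P] for trees and parent sequences, [SYT_cols2P]
    for tableaux and ballot words, and [prod_sigma_tableau] for the weights. *)

(** * Sums, cardinals and sorted sequences *)

Lemma sum_set_image (V : nmodType) (I : eqType) (J : finType) (A : {set J})
    (h : I -> J) (r : seq I) (F : J -> V) :
    uniq r -> {in r &, injective h} ->
    (forall j, j \in A <-> exists2 i, i \in r & j = h i) ->
  (\sum_(j in A) F j = \sum_(i <- r) F (h i))%R.
Proof.
move=> r_uniq h_inj A_image.
rewrite -(big_map h predT) big_uniq ?map_inj_in_uniq //=.
apply: eq_bigl => j; apply/idP/mapP => /A_image //.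
Qed.

Lemma card_ord_interval n a b :
  #|[set i : 'I_n | a <= i < b]| = minn b n - a.
Proof.
rewrite -sum1_card big_mkcond /=.
under eq_bigr do rewrite inE.
elim: n => [|n IHn]; first by rewrite big_ord0 minn0.
by rewrite big_ord_recr /= IHn; case: ifP; lia.
Qed.

(** In a strictly increasing sequence the entries bounded by i form a prefix, so
    comparing the r-th entry with i amounts to counting. This is how prefix
    counts of a word are traded for inequalities between tableau entries. *)
Lemma nth_leq_sorted p r i :
  sorted ltn p -> (r < size p) && (nth 0 p r <= i) = (r < count (leq^~ i) p).
Proof.
elim: p r => [|x p IHp] r //= sorted_p.
have := order_path_min ltn_trans sorted_p => /allP lt_x.
have [le_xi|lt_ix] := leqP x i.
  by case: r => [|r] //=; rewrite !ltnS IHp // (path_sorted sorted_p).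
rewrite (_ : count _ p = 0); last first.
  apply/eqP; rewrite -leqn0 leqNgt -has_count; apply/hasPn => y /lt_x /= lt_xy.
  by rewrite -ltnNge (ltn_trans lt_ix).
case: r => [|r] /=; first by rewrite leqNgt lt_ix.
rewrite ltnS; apply/negP => /andP[/(mem_nth 0)/lt_x /= lt_xr].
by rewrite leqNgt (ltn_trans lt_ix).
Qed.

(** The rows of a partition that reach beyond column c form a prefix; the count
    is the height of that column, a part of the conjugate partition. *)
Lemma geq_sorted_nth (la : seq nat) r c :
  sorted geq la -> (c < nth 0 la r) = (r < count (fun l => c < l) la).
Proof.
elim: la r => [|x la IHla] r; first by rewrite nth_nil.
have geq_trans : transitive geq by move=> y z t /= le_yz /leq_trans; apply.
move=> /= sorted_la; have := order_path_min geq_trans sorted_la => /allP le_x.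
have {}IHla := IHla _ (path_sorted sorted_la).
have [lt_cx|le_xc] := ltnP c x; first by case: r => [|r] //=; rewrite IHla.
rewrite (_ : count _ la = 0); last first.
  apply/eqP; rewrite -leqn0 leqNgt -has_count; apply/hasPn => y /le_x /= le_yx.
  by rewrite -leqNgt (leq_trans le_yx).
case: r => [|r] /=; first by rewrite ltnNge le_xc.
apply/negbTE; rewrite -leqNgt.
have [lt_r|le_r] := ltnP r (size la); last by rewrite nth_default.
by rewrite (leq_trans _ le_xc) //; apply: le_x; apply: mem_nth.
Qed.

(** * The growth operator *)

(** If F l u is the weight of an object with l leaves and u unary vertices, then
    [grow F] l u is the total weight of the objects obtained from it by one
    insertion. Acting on an arbitrary F, instead of on monomials, lets
    both inductions below peel off the last insertion. *)
Definition grow (V : nmodType) (F : nat -> nat -> V) (l u : nat) : V :=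
  (F l u.+1 *+ l + F l.+1 u.-1 *+ u)%R.

(** * Parent sequences *)

(** Entry i of the sequence s is the parent of the vertex i + 1, so the degree
    of u is the number of its occurrences in s. *)
Definition attachable (m : nat) (s : seq nat) : seq nat :=
  [seq u <- iota 0 m.+1 | count_mem u s < 2].

Fixpoint parent_seqs (m : nat) : seq (seq nat) :=
  if m is m'.+1 then
    [seq rcons s u | s <- parent_seqs m', u <- attachable m' s]
  else [:: [::]].

Lemma parent_seqsP m s :
  s \in parent_seqs m <->
  [/\ size s = m, forall i, i < m -> nth 0 s i <= i
    & forall u, count_mem u s <= 2].
Proof.
elim: m s => [|m IHm] s /=.
  by rewrite inE; split=> [/eqP-> //|[/eqP/nilP->]].
split=> [/allpairsPdep[t [u [/IHm[sz_t le_t deg_t]]]]|].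
  rewrite mem_filter mem_iota leq0n add0n => /andP[deg_u lt_u] ->.
  split=> [|i lt_i|v]; first by rewrite size_rcons sz_t.
    rewrite nth_rcons sz_t; case: ltngtP => [/le_t //|lt_mi|->]; last by [].
    by rewrite ltnS leqNgt lt_mi in lt_i.
  rewrite -cats1 count_cat /= addn0; case: eqP => [<-|_].
    by rewrite addn1.
  by rewrite addn0.
case/lastP: s => [|t u]; first by case.
rewrite size_rcons => -[[sz_t] le_s deg_s].
apply/allpairsPdep; exists t, u; split=> //.
  apply/IHm; split=> // [i lt_i|v].
    by have := le_s i (ltnW lt_i); rewrite nth_rcons sz_t lt_i.
  by apply: leq_trans (deg_s v); rewrite -cats1 count_cat leq_addr.
have := le_s m (leqnn _); rewrite nth_rcons sz_t ltnn eqxx => le_u.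
rewrite mem_filter mem_iota leq0n add0n [u < _]ltnS le_u andbT.
by have := deg_s u; rewrite -cats1 count_cat /= eqxx addn0 addn1 => ->.
Qed.

Lemma parent_seqs_uniq m : uniq (parent_seqs m).
Proof.
elim: m => //= m IHm; apply: allpairs_uniq_dep => // [s _|].
  exact: filter_uniq (iota_uniq _ _).
by move=> [s u] [t v] _ _ /= /rcons_inj[-> ->].
Qed.

Definition count_degree (k : nat) (s : seq nat) : nat :=
  count (fun v => count_mem v s == k) (iota 0 (size s).+1).

(** Appending u to s changes the degree of u only, and creates the leaf m + 1.
    The two additions in place of a difference keep the equation
    valid for natural numbers. *)
Lemma count_degree_rcons k m s u :
    s \in parent_seqs m -> u <= m ->
  count_degree k (rcons s u) + (count_mem u s == k) =
  count_degree k s + ((count_mem u s).+1 == k) + (k == 0).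
Proof.
move=> /parent_seqsP[sz_s le_s _] le_u.
have countE v : count_mem v (rcons s u) = count_mem v s + (u == v).
  by rewrite -cats1 count_cat /= addn0.
have new_leaf : count_mem m.+1 (rcons s u) = 0.
  apply/count_memPn; apply/negP; rewrite mem_rcons inE => /predU1P[eq_u|].
    by rewrite -eq_u ltnn in le_u.
  case/(nthP 0) => i; rewrite sz_s => lt_i eq_i.
  by have := leq_ltn_trans (le_s i lt_i) lt_i; rewrite eq_i ltnNge leqnSn.
rewrite /count_degree size_rcons sz_s -[m.+2]addn1 iotaD.
have r_uniq : uniq (iota 0 m.+1) by apply: iota_uniq.
have u_in : u \in iota 0 m.+1 by rewrite mem_iota leq0n add0n ltnS.
move: (iota 0 m.+1) r_uniq u_in => r r_uniq u_in.
rewrite count_cat /= add0n new_leaf addn0 [0 == k]eq_sym.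
rewrite ![count _ r](permP (perm_to_rem u_in)) /= countE eqxx addn1.
have -> : count (fun v => count_mem v (rcons s u) == k) (rem u r) =
          count (fun v => count_mem v s == k) (rem u r).
  apply: eq_in_count => v; rewrite mem_rem_uniq // inE => /andP[/= nvu _].
  by rewrite countE [u == v]eq_sym (negPf nvu) addn0.
by rewrite [RHS](ACl (3*2*4*1))/=.
Qed.

Lemma sum_parent_seqs (V : nmodType) (F : nat -> nat -> V) m :
  (\sum_(s <- parent_seqs m) F (count_degree 0 s) (count_degree 1 s) =
   iter m (@grow V) F 1 0)%R.
Proof.
elim: m F => [|m IHm] F; first by rewrite /= big_seq1.
rewrite iterSr -IHm /= big_allpairs_dep /=.
apply: eq_big_seq => s s_in; have [sz_s _ _] := (parent_seqsP _ _).1 s_in.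
have degreesE k : count_degree k s =
    count (fun v => count_mem v s == k) (iota 0 m.+1).
  by rewrite /count_degree sz_s.
rewrite big_filter (bigID (fun u => count_mem u s == 0)) /=.
transitivity (\sum_(u <- iota 0 m.+1 | count_mem u s == 0%N)
                F (count_degree 0 s) (count_degree 1 s).+1 +
              \sum_(u <- iota 0 m.+1 | count_mem u s == 1%N)
                F (count_degree 0 s).+1 (count_degree 1 s).-1)%R; last first.
  by rewrite !big_const_seq !iter_addr_0 -!degreesE.
have le_vertex u : u \in iota 0 m.+1 -> u <= m.
  by rewrite mem_iota leq0n add0n ltnS.
congr (_ + _)%R; rewrite big_seq_cond [RHS]big_seq_cond.
  apply: eq_big => [u|u /andP[/le_vertex le_u /andP[_ /eqP deg_u]]].
    by case: (count_mem u s) => [|[|k]]; rewrite ?andbT ?andbF.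
  have := count_degree_rcons 1 s_in le_u.
  have := count_degree_rcons 0 s_in le_u.
  by rewrite deg_u /= !addn0 !addn1 => -[->] ->.
apply: eq_big => [u|u /andP[/le_vertex le_u deg_u]].
  by case: (count_mem u s) => [|[|k]]; rewrite ?andbT ?andbF.
have {}deg_u : count_mem u s = 1 by case: (count_mem u s) deg_u => [|[]].
have := count_degree_rcons 1 s_in le_u.
have := count_degree_rcons 0 s_in le_u.
by rewrite deg_u /= !addn0 !addn1 => -> <-.
Qed.

(** * Increasing trees and parent sequences *)

Definition tree_of_parents (m : nat) (s : seq nat) : digraph m :=
  [set e : 'I_m.+1 * 'I_m.+1 | (0 < e.2) && (nth 0 s e.2.-1 == e.1)].

Lemma edge_tree_of_parents m s (u v : 'I_m.+1) :
  edge (tree_of_parents m s) u v = (0 < v) && (nth 0 s v.-1 == u).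
Proof. by rewrite /edge inE. Qed.

Lemma degree_tree_of_parents m s (u : 'I_m.+1) :
  size s = m -> degree (tree_of_parents m s) u = count_mem (val u) s.
Proof.
move=> sz_s; rewrite /degree -sum1_card big_mkcond big_ord_recl inE.
rewrite edge_tree_of_parents /= add0n -sum1_count [RHS]big_mkcond /=.
rewrite (big_nth 0) big_mkord sz_s; apply: eq_bigr => i _.
by rewrite inE edge_tree_of_parents.
Qed.

Lemma card_degree_tree_of_parents m s k :
    size s = m ->
  #|[set u | degree (tree_of_parents m s) u == k]| = count_degree k s.
Proof.
move=> sz_s; rewrite /count_degree sz_s -sum1_count -sum1_card.
rewrite big_mkcond [RHS]big_mkcond.
rewrite -[iota 0 m.+1]/(index_iota 0 m.+1) big_mkord.
by apply: eq_bigr => u _; rewrite inE degree_tree_of_parents.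
Qed.

(** Following parents decreases labels, so a strong induction on v rebuilds the
    only path from the root to v backwards. *)
Lemma increasing_tree_of_parents m s :
    (forall i, i < m -> nth 0 s i <= i) ->
  increasing_tree (tree_of_parents m s).
Proof.
move=> le_s.
have edge_lt (u v : 'I_m.+1) : edge (tree_of_parents m s) u v -> u < v.
  rewrite edge_tree_of_parents => /andP[v_gt0 /eqP <-].
  rewrite -[X in _ < X]prednK // ltnS le_s // -ltnS prednK //; exact: ltn_ord.
split; last by move=> p; apply: sub_path.
move=> v; have [k lt_vk] := ubnP (nat_of_ord v).
elim: k => // k IHk in v lt_vk *.
have [v0|v_gt0] := posnP v.
  exists [::]; split; first by split=> //; apply: val_inj.
  move=> p; case/lastP: p => // p w [].
  rewrite rcons_path last_rcons => /andP[_ /edge_lt] lt eq_w.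
  by rewrite eq_w v0 in lt.
have lt_par : nth 0 s v.-1 < v.
  by rewrite -[X in _ < X]prednK // ltnS le_s // -ltnS prednK //; exact: ltn_ord.
pose u : 'I_m.+1 := Ordinal (ltn_trans lt_par (ltn_ord v)).
have [p [[path_p last_p] p_uniq]] := IHk u (leq_trans lt_par lt_vk).
exists (rcons p v); split.
  rewrite rcons_path path_p last_p last_rcons edge_tree_of_parents v_gt0.
  by rewrite /= eqxx.
move=> q; case/lastP: q => [|q w] [].
  by move=> _ /(congr1 val) /= v0; rewrite -v0 in v_gt0.
rewrite rcons_path last_rcons => /andP[path_q edge_w] eq_w.
rewrite eq_w in edge_w *; congr rcons; apply: p_uniq; split=> //.
apply: val_inj => /=; move: edge_w.
by rewrite edge_tree_of_parents => /andP[_ /eqP].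
Qed.

Lemma tree_of_parents_inj m :
  {in parent_seqs m &, injective (tree_of_parents m)}.
Proof.
move=> s t /parent_seqsP[sz_s le_s _] /parent_seqsP[sz_t _ _] eq_st.
apply: (@eq_from_nth _ 0) => [|i]; rewrite sz_s // => lt_i.
have lt_par : nth 0 s i < m.+1.
  by rewrite ltnS (leq_trans (le_s i lt_i)) // ltnW.
have /setP/(_ (Ordinal lt_par, Ordinal (lt_i : i.+1 < m.+1))) := eq_st.
by rewrite !inE /= eqxx => /esym/eqP.
Qed.

(** A second parent of v would give a second path from the root to v, and every
    vertex except 0 is the end of a nonempty path, hence has a parent. *)
Lemma increasing_tree_parents m (T : digraph m) :
    increasing_tree T ->
  exists s : seq nat,
    [/\ size s = m, forall i, i < m -> nth 0 s i <= i
      & T = tree_of_parents m s].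
Proof.
move=> [T_tree T_incr].
have edge_lt (u v : 'I_m.+1) : edge T u v -> u < v.
  move=> uv; have [p [[path_p last_p] _]] := T_tree u.
  have := T_incr (rcons p v); rewrite !rcons_path path_p last_p uv.
  by move=> /(_ isT)/andP[].
have edge_parent (v : 'I_m.+1) : 0 < v -> exists u, edge T u v.
  move=> v_gt0; have [p [[path_p last_p] _]] := T_tree v.
  case/lastP: p => [|p w] in path_p last_p; first by rewrite -last_p in v_gt0.
  move: path_p last_p; rewrite rcons_path last_rcons => /andP[_ edge_w] <-.
  by exists (last ord0 p).
have edge_uniq (u u' v : 'I_m.+1) : edge T u v -> edge T u' v -> u = u'.
  move=> uv u'v; have [p [[path_p last_p] _]] := T_tree u.
  have [p' [[path_p' last_p'] _]] := T_tree u'.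
  have [q [_ q_uniq]] := T_tree v.
  have qE : q = rcons p v.
    by apply: q_uniq; rewrite rcons_path last_rcons path_p last_p.
  have : q = rcons p' v.
    by apply: q_uniq; rewrite rcons_path last_rcons path_p' last_p'.
  by rewrite qE => /rcons_inj[eq_p]; rewrite -last_p eq_p.
pose parent (i : nat) : 'I_m.+1 := odflt ord0 [pick u | edge T u (inord i.+1)].
have parentP i : i < m -> edge T (parent i) (inord i.+1).
  move=> lt_i; rewrite /parent; case: pickP => //= none.
  have [|u] := edge_parent (inord i.+1); first by rewrite inordK.
  by rewrite none.
exists (mkseq (fun i => val (parent i)) m).
split=> [|i lt_i|]; first by rewrite size_mkseq.
  by rewrite nth_mkseq //; have := edge_lt _ _ (parentP i lt_i); rewrite inordK.
apply/setP => -[u v]; rewrite inE /=; apply/idP/andP => [uv|].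
  have v_gt0 : 0 < v by apply: leq_ltn_trans (edge_lt u v uv).
  have lt_v : v.-1 < m by rewrite -ltnS prednK.
  split=> //; rewrite nth_mkseq //; apply/eqP; congr val.
  apply: (edge_uniq _ _ v) => //.
  by have := parentP _ lt_v; rewrite prednK ?inord_val.
move=> [v_gt0]; have lt_v : v.-1 < m by rewrite -ltnS prednK.
rewrite nth_mkseq // => /eqP/val_inj <-.
by have := parentP _ lt_v; rewrite prednK ?inord_val.
Qed.

Lemma trees012P m (T : digraph m) :
  T \in trees012 m <-> exists2 s, s \in parent_seqs m & T = tree_of_parents m s.
Proof.
rewrite inE.
split=> [/asboolP[T_incr T_deg]|[s /parent_seqsP[sz_s le_s deg_s] ->]].
  have [s [sz_s le_s T_s]] := increasing_tree_parents T_incr.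
  exists s => //; apply/parent_seqsP; split=> // u.
  have [lt_u|le_u] := ltnP u m.+1.
    by have := T_deg (Ordinal lt_u); rewrite T_s degree_tree_of_parents.
  rewrite (count_memPn _) //; apply/negP => /(nthP 0)[i].
  rewrite sz_s => lt_i eq_u.
  by have := leq_ltn_trans (le_s i lt_i) lt_i; rewrite eq_u ltnNge ltnW.
apply/asboolP; split=> [|u]; first exact: increasing_tree_of_parents.
by rewrite degree_tree_of_parents.
Qed.

Lemma sum_trees012 (V : nmodType) (F : nat -> nat -> V) m :
  (\sum_(T in trees012 m) F (leaves T) (unary T) = iter m (@grow V) F 1 0)%R.
Proof.
rewrite -sum_parent_seqs.
rewrite (sum_set_image _ (parent_seqs_uniq m) (@tree_of_parents_inj m)
                       (@trees012P m)).
apply: eq_big_seq => s /parent_seqsP[sz_s _ _].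
by rewrite /leaves /unary !card_degree_tree_of_parents.
Qed.

(** * Ballot words *)

Lemma count_memC (w : seq bool) : count_mem true w + count_mem false w = size w.
Proof. by elim: w => //= -[] w <-; lia. Qed.

(** The letter true stands for the second column and false for the first. *)
Definition ballot (w : seq bool) : Prop :=
  forall i, count_mem true (take i w) <= count_mem false (take i w).

Lemma ballot_le w : ballot w -> count_mem true w <= count_mem false w.
Proof. by move=> /(_ (size w)); rewrite take_size. Qed.

Lemma ballot_rcons w c :
  ballot (rcons w c) <->
  ballot w /\ c ==> (count_mem true w < count_mem false w).
Proof.
have take_w i : i <= size w -> take i (rcons w c) = take i w.
  by move=> le_i; rewrite -cats1 takel_cat.
have last_letter :
    (count_mem true (rcons w c) <= count_mem false (rcons w c)) =
    if c then count_mem true w < count_mem false w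
    else count_mem true w <= (count_mem false w).+1.
  by rewrite -cats1 !count_cat; case: c {take_w} => /=; rewrite !addn0 !addn1.
split=> [bal|[bal bal_c] i].
  split=> [i|]; last first.
    have := ballot_le bal; rewrite last_letter.
    by case: c {take_w bal last_letter}.
  have [le_i|lt_i] := leqP i (size w); first by rewrite -take_w.
  by rewrite take_oversize ?(ltnW lt_i) // -[w]take_size -take_w.
have [le_i|lt_i] := leqP i (size w); first by rewrite take_w.
rewrite take_oversize ?size_rcons // last_letter.
case: c bal_c {take_w last_letter} => //= _.
by rewrite (leq_trans (ballot_le bal)).
Qed.

Definition next_letters (w : seq bool) : seq bool :=
  [seq c <- [:: false; true] | c ==> (count_mem true w < count_mem false w)].

Fixpoint ballots (n : nat) : seq (seq bool) :=
  if n is n'.+1 then [seq rcons w c | w <- ballots n', c <- next_letters w]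
  else [:: [::]].

Lemma ballotsP n w : w \in ballots n <-> size w = n /\ ballot w.
Proof.
elim: n w => [|n IHn] w.
  by rewrite inE; split=> [/eqP->|[/eqP/nilP-> //]]; split=> // -[].
have next v c : (c \in next_letters v) =
    (c ==> (count_mem true v < count_mem false v)).
  by rewrite mem_filter; case: c; rewrite /= ?andbT.
split=> [/allpairsPdep[v [c [/IHn[sz_v bal_v]]]]|].
  rewrite next => bal_c ->; rewrite size_rcons sz_v; split=> //.
  exact/ballot_rcons.
case/lastP: w => [|v c] [] //.
rewrite size_rcons => -[sz_v] /ballot_rcons[bal bal_c].
by apply/allpairsPdep; exists v, c; rewrite next; split=> //; apply/IHn.
Qed.

Lemma ballots_uniq n : uniq (ballots n).
Proof.
elim: n => // n IHn; apply: allpairs_uniq_dep => // [w _|].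
  exact: filter_uniq.
by move=> [v c] [w d] _ _ /= /rcons_inj[-> ->].
Qed.

(** The box sorting index of the entry that corresponds to a letter c appended
    to w, in terms of the two column sizes before the insertion. *)
Definition letter_weight (w : seq bool) (c : bool) : nat :=
  if c then count_mem false w - count_mem true w else (count_mem true w).+1.

Definition word_weight (w : seq bool) : nat :=
  \prod_(i < size w) letter_weight (take i w) (nth false w i).

Lemma word_weight_rcons w c :
  word_weight (rcons w c) = word_weight w * letter_weight w c.
Proof.
rewrite /word_weight size_rcons big_ord_recr /= nth_rcons ltnn eqxx.
rewrite -cats1 take_size_cat //; congr (_ * _); apply: eq_bigr => i _.
by rewrite takel_cat ?nth_cat ?ltn_ord // ltnW.
Qed.

(** With b letters true and a letters false, the associated tree parameters are
    l = b + 1 and u = a - b. The letter true is forbidden when a = b, which is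
    exactly when its weight u vanishes. *)
Lemma sum_ballots (V : nmodType) (F : nat -> nat -> V) n :
  (\sum_(w <- ballots n)
     F (count_mem true w).+1 (count_mem false w - count_mem true w)%N
       *+ word_weight w =
   iter n (@grow V) F 1 0)%R.
Proof.
elim: n F => [|n IHn] F; first by rewrite /= big_seq1 /word_weight big_ord0.
rewrite iterSr -IHn big_allpairs_dep.
apply: eq_big_seq => w /ballotsP[_ /ballot_le bal].
rewrite big_filter !big_cons big_nil /=.
rewrite !word_weight_rcons -!cats1 !count_cat /= !addn0 !addn1.
rewrite /grow mulrnDl -!mulrnA subSn // mulnC [in X in (_ + X)%R]mulnC subnS.
congr (_ + _)%R; case: ltnP => [_|le_ab]; first by rewrite addr0.
by rewrite (eqP le_ab) mulr0n.
Qed.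

(** * The positions of a letter *)

(** Positions are counted from 1, as the entries of a tableau are. *)
Definition entries (w : seq bool) (d : bool) : seq nat :=
  [seq k <- iota 1 (size w) | nth false w k.-1 == d].

Lemma mem_entries w d k :
  (k \in entries w d) = (0 < k <= size w) && (nth false w k.-1 == d).
Proof. by rewrite mem_filter mem_iota add1n ltnS andbC. Qed.

Lemma entries_sorted w d : sorted ltn (entries w d).
Proof. exact: sorted_filter ltn_trans _ _ (iota_ltn_sorted _ _). Qed.

Lemma count_leq_entries w d i :
  i <= size w -> count (leq^~ i) (entries w d) = count_mem d (take i w).
Proof.
move=> le_i; rewrite /entries -{1}(subnKC le_i) iotaD filter_cat count_cat.
rewrite [X in _ + X](_ : _ = 0) ?addn0; last first.
  apply/eqP; rewrite -leqn0 leqNgt -has_count; apply/hasPn => y.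
  by rewrite mem_filter mem_iota add1n -ltnNge => /and3P[].
have -> : take i w = [seq nth false w k.-1 | k <- iota 1 i].
  by rewrite (iotaDl 1 0) -map_comp -[LHS](map_nth_iota0 false).
rewrite count_map count_filter; apply: eq_in_count => k.
by rewrite mem_iota add1n ltnS /= => /andP[_ ->].
Qed.

Lemma size_entries w d : size (entries w d) = count_mem d w.
Proof.
rewrite -[in RHS](take_size w) -count_leq_entries //; apply/esym/eqP.
by rewrite -all_count; apply/allP => k; rewrite mem_entries => /andP[/andP[]].
Qed.

Lemma nth_entries_leq w d r i :
    i <= size w ->
  (r < size (entries w d)) && (nth 0 (entries w d) r <= i) =
  (r < count_mem d (take i w)).
Proof.
by move=> le_i; rewrite nth_leq_sorted ?entries_sorted // count_leq_entries.
Qed.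

Lemma nth_entries_le w d r : nth 0 (entries w d) r <= size w.
Proof.
have [lt_r|le_r] := ltnP r (size (entries w d)); last by rewrite nth_default.
by have := mem_nth 0 lt_r; rewrite mem_entries => /andP[/andP[]].
Qed.

Lemma nth_entries_neq0 w d r :
  (nth 0 (entries w d) r != 0) = (r < count_mem d w).
Proof.
rewrite -size_entries; have [lt_r|le_r] := ltnP; last by rewrite nth_default.
by have := mem_nth 0 lt_r; rewrite mem_entries -lt0n => /andP[/andP[]].
Qed.

(** If the true letter of index r is at position k, then the prefix of length k
    has more than r true letters, hence more than r false ones by the ballot property. *)
Lemma entries_ballot w r :
    ballot w -> r < size (entries w true) ->
  nth 0 (entries w false) r < nth 0 (entries w true) r.
Proof.
move=> bal lt_r; set k := nth 0 (entries w true) r.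
have : k \in entries w true by apply: mem_nth.
rewrite mem_entries => /andP[/andP[k_gt0 le_k] /eqP k_true].
have : r < count_mem true (take k w) by rewrite -nth_entries_leq // lt_r leqnn.
move=> /leq_trans/(_ (bal k)).
rewrite -nth_entries_leq // => /andP[lt_r' le_rk].
rewrite ltn_neqAle le_rk andbT; apply/eqP => eq_k.
have := mem_nth 0 lt_r'; rewrite eq_k mem_entries => /andP[_].
by rewrite k_true.
Qed.

Lemma ballot_entries w :
    (forall r, r < size (entries w true) ->
       r < size (entries w false) /\
       nth 0 (entries w false) r < nth 0 (entries w true) r) ->
  ballot w.
Proof.
move=> lt_entries i; wlog le_i : i / i <= size w.
  move=> IH; have [/IH //|/ltnW le_i] := leqP i (size w).
  by rewrite take_oversize // -[w]take_size; apply: IH.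
rewrite leqNgt; apply/negP => lt_ft.
have := lt_ft; rewrite -nth_entries_leq // => /andP[/lt_entries[lt_r lt_f] le_t].
have : count_mem false (take i w) < count_mem false (take i w).
  by rewrite -nth_entries_leq // lt_r ltnW // (leq_trans lt_f).
by rewrite ltnn.
Qed.

(** * From ballot words to tableaux *)

Lemma ltn2_bool c : c < 2 -> exists d : bool, c = d.
Proof. by case: c => [|[|]] // _; [exists false | exists true]. Qed.

(** The default value 0 of [nth] marks the grid positions above a column. *)
Definition tableau (n : nat) (w : seq bool) : filling n :=
  [ffun b : 'I_n * 'I_n =>
    inord (if b.2 < 2 then nth 0 (entries w (b.2 == 1 :> nat)) b.1
           else 0)].

Lemma tableauE n w (r c : 'I_n) (d : bool) :
    size w = n -> c = d :> nat ->
  tableau n w (r, c) = nth 0 (entries w d) r :> nat.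
Proof.
move=> sz_w eq_c; rewrite ffunE /= eq_c ltnS leq_b1.
have -> : (d == 1 :> nat) = d by case: d {eq_c}.
by rewrite inordK // ltnS -[leqRHS]sz_w nth_entries_le.
Qed.

Lemma tableau_out n w (r c : 'I_n) : 2 <= c -> tableau n w (r, c) = 0 :> nat.
Proof. by move=> le_c; rewrite ffunE /= ltnNge le_c /= inordK. Qed.

Definition shape (w : seq bool) : seq nat :=
  nseq (count_mem true w) 2 ++ nseq (count_mem false w - count_mem true w) 1.

Lemma nth_shape w r :
    ballot w ->
  nth 0 (shape w) r = (r < count_mem false w) + (r < count_mem true w).
Proof.
move=> /ballot_le bal; rewrite nth_cat !nth_nseq size_nseq.
by case: ifP; case: ifP; lia.
Qed.

Lemma shape_partition w : ballot w -> is_partition (size w) (shape w).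
Proof.
move=> bal; split.
- by apply/(sortedP 0) => r _; rewrite !nth_shape //=; lia.
- by rewrite all_cat !all_nseq !orbT.
- by rewrite sumn_cat !sumn_nseq -count_memC; have := ballot_le bal; lia.
Qed.

(** The tableau is filled column by column, with a boxes in the first column and
    b in the second; since b <= a, these boxes also form left-justified rows of
    lengths (r < a) + (r < b). *)
Lemma tableau_neq0 n w (b : 'I_n * 'I_n) :
    size w = n -> ballot w ->
  (tableau n w b != 0 :> nat) = in_diagram (shape w) b.
Proof.
case: b => r c sz_w bal; rewrite /in_diagram nth_shape //=.
have [/ltn2_bool[d eq_d]|le_c] := ltnP c 2; last first.
  by rewrite tableau_out //; lia.
rewrite (tableauE _ sz_w eq_d) nth_entries_neq0 eq_d.
by have := ballot_le bal; case: d {eq_d} => /=; lia.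
Qed.

Lemma tableau_box n w k :
    size w = n -> ballot w -> 0 < k <= n ->
  exists b : 'I_n * 'I_n,
    b.2 = nth false w k.-1 :> nat /\ tableau n w b = k :> nat.
Proof.
move=> sz_w bal /andP[k_gt0 le_k]; set d := nth false w k.-1.
have k_in : k \in entries w d by rewrite mem_entries k_gt0 sz_w le_k /= eqxx.
have lt_r : index k (entries w d) < count_mem d w.
  by rewrite -size_entries index_mem.
have := count_memC w; have := ballot_le bal; rewrite sz_w => le_tf tfE.
have r_n : index k (entries w d) < n by apply: leq_trans lt_r _; case: (d); lia.
have c_n : d < n.
  have : 0 < count_mem d w by apply: leq_ltn_trans lt_r.
  by move: le_tf tfE; case: (d) => /=; lia.
exists (Ordinal r_n, Ordinal c_n); split=> //.
by rewrite (tableauE _ (d := d)) //= nth_index.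
Qed.

Lemma tableau_entry n w (b : 'I_n * 'I_n) k :
    size w = n -> tableau n w b = k :> nat -> 0 < k ->
  b.2 = nth false w k.-1 :> nat /\
  b.1 = index k (entries w (nth false w k.-1)) :> nat.
Proof.
case: b => r c sz_w eq_k k_gt0.
have [/ltn2_bool[d eq_d]|le_c] := ltnP c 2; last first.
  by move: k_gt0; rewrite -eq_k tableau_out.
move: eq_k; rewrite (tableauE _ sz_w eq_d) => eq_k.
have lt_r : r < size (entries w d).
  by rewrite size_entries -nth_entries_neq0 eq_k -lt0n.
have := mem_nth 0 lt_r; rewrite eq_k mem_entries => /andP[_ /eqP ->] /=.
rewrite eq_d -eq_k index_uniq //; exact: filter_uniq (iota_uniq _ _).
Qed.

Lemma tableau_SYT_cols n w :
  size w = n -> ballot w -> tableau n w \in SYT_cols n 2.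
Proof.
move=> sz_w bal; rewrite !inE; apply/andP; split; last first.
  have le2 : #|[set c : 'I_n | 0 <= c < 2]| <= 2.
    by rewrite card_ord_interval; lia.
  apply: leq_trans (subset_leq_card _) le2; apply/subsetP => c.
  rewrite !inE => /existsP[r]; apply: contraNT; rewrite -leqNgt => le_c.
  by rewrite tableau_out.
apply/asboolP; exists (shape w); split.
  by rewrite -sz_w; apply: shape_partition.
split=> [b|k k_n|r c c'|r r' c].
- exact: tableau_neq0.
- have [b [_ b_k]] := tableau_box sz_w bal k_n.
  have k_gt0 : 0 < k by case/andP: k_n.
  exists b; split=> // b' b'_k.
  have [c_b r_b] := tableau_entry sz_w b_k k_gt0.
  have [c_b' r_b'] := tableau_entry sz_w b'_k k_gt0.
  case: b b' {b_k b'_k} c_b r_b c_b' r_b' => [r c] [r' c'] /= cE rE cE' rE'.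
  by congr (_, _); apply: val_inj; rewrite /= ?cE ?cE' ?rE ?rE'.
- rewrite -!tableau_neq0 // => nz nz' lt_c.
  have [le_c'|lt_c'] := leqP 2 c'; first by rewrite tableau_out in nz'.
  have c0 : c = false :> nat by move: lt_c lt_c' => /=; lia.
  have c1 : c' = true :> nat by move: lt_c lt_c' => /=; lia.
  move: nz'; rewrite (tableauE _ sz_w c0) (tableauE _ sz_w c1) => nz'.
  by apply: entries_ballot; rewrite // size_entries -nth_entries_neq0.
- rewrite -!tableau_neq0 // => nz nz' lt_r.
  have [le_c|/ltn2_bool[d eq_d]] := leqP 2 c.
    by rewrite tableau_out in nz.
  move: nz nz'; rewrite !(tableauE _ sz_w eq_d) !nth_entries_neq0.
  rewrite -!size_entries.
  by move=> *; apply: (sorted_ltn_nth ltn_trans 0 (entries_sorted w d)).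
Qed.

(** The letter at position k is read off the column that contains k. *)
Lemma tableau_inj n : {in ballots n &, injective (tableau n)}.
Proof.
move=> w w' /ballotsP[sz_w bal] /ballotsP[sz_w' _] eq_ww'.
apply: (@eq_from_nth _ false) => [|i]; rewrite sz_w // => lt_i.
have [b [c_b b_i]] := @tableau_box n w i.+1 sz_w bal lt_i.
have [] := @tableau_entry n w' b i.+1 sz_w'; rewrite -?eq_ww' //= c_b.
by case: (nth _ w i); case: (nth _ w' i).
Qed.

(** * From tableaux to ballot words *)

(** The word w of T is read off the columns of its entries. Each column of T,
    read upwards, is a strictly increasing sequence with the same members as
    the corresponding [entries] of w, so the two sequences are equal; the
    ballot property of w then follows from the increase along rows. *)
Lemma SYT_cols_tableau n (T : filling n) :
  T \in SYT_cols n 2 -> exists2 w, w \in ballots n & T = tableau n w.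
Proof.
rewrite !inE => /andP[/asboolP[la [[la_geq _ _]]]].
move=> [T_neq0 T_uniq T_row T_col] T_cols.
have T_out (r c : 'I_n) : 2 <= c -> T (r, c) = 0 :> nat.
  move=> le_c; apply/eqP/negPn/negP; rewrite T_neq0 => rc_in.
  (* A box in the third column or beyond forces three nonempty columns. *)
  suff : 2 < ncols T by rewrite ltnNge T_cols.
  have <- : #|[set c' : 'I_n | 0 <= c' < 3]| = 3.
    by rewrite card_ord_interval; have := ltn_ord c; lia.
  apply: subset_leq_card; apply/subsetP => c'; rewrite !inE => lt_c'.
  apply/existsP; exists r; rewrite T_neq0; move: rc_in; rewrite /in_diagram /=.
  by apply: leq_ltn_trans; apply: leq_trans le_c.
pose w := mkseq (fun k =>
  [exists b : 'I_n * 'I_n, (b.2 == 1 :> nat) && (T b == k.+1 :> nat)]) n.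
have sz_w : size w = n by rewrite size_mkseq.
have T_letter (b : 'I_n * 'I_n) :
    T b != 0 :> nat -> b.2 = nth false w (T b).-1 :> nat.
  rewrite -lt0n => Tb_gt0.
  have Tb_n : 1 <= T b <= n by rewrite Tb_gt0 -ltnS ltn_ord.
  have lt_b2 : b.2 < 2.
    rewrite ltnNge; apply/negP => /(T_out b.1).
    by rewrite -surjective_pairing; lia.
  rewrite nth_mkseq ?prednK //; last by case/andP: Tb_n.
  case: existsP => [[b' /andP[/eqP b'2 /eqP eq_b']]|none].
    have [b0 [_ b0_uniq]] := T_uniq _ Tb_n.
    by rewrite -(b0_uniq b) // (b0_uniq b').
  have : b.2 != 1 :> nat.
    by apply/eqP => b2; case: none; exists b; rewrite b2 !eqxx.
  by move: lt_b2; case: (nat_of_ord b.2) => [|[]].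
have T_column (r c : 'I_n) (d : bool) :
    c = d :> nat -> T (r, c) = nth 0 (entries w d) r :> nat.
  (* h is the height of column c; the minimum with n makes the rows below h
     rows of the grid at once, whatever the number of parts of la. *)
  move=> eq_d; pose h := minn n (count (fun l => c < l) la).
  have h_neq0 (s : 'I_n) : (T (s, c) != 0 :> nat) = (s < h).
    by rewrite T_neq0 /in_diagram geq_sorted_nth //= /h leq_min ltn_ord.
  pose f s := if insub s is Some s' then nat_of_ord (T (s' : 'I_n, c)) else 0.
  have fE (s : 'I_n) : f s = T (s, c) by rewrite /f valK.
  suff -> : entries w d = mkseq f h.
    have [lt_r|le_r] := ltnP r h; first by rewrite nth_mkseq // fE.
    rewrite nth_default ?size_mkseq //; apply/eqP/negPn.
    by rewrite h_neq0 -leqNgt.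
  have lt_hn s : s < h -> s < n.
    by move=> lt_s; rewrite (leq_trans lt_s) ?geq_minl.
  apply: (irr_sorted_eq ltn_trans ltnn) (entries_sorted _ _) _ _.
    apply/(sortedP 0) => s; rewrite size_mkseq => lt_s.
    rewrite !nth_mkseq ?(ltnW lt_s) //.
    rewrite (fE (Ordinal (lt_hn _ lt_s))) (fE (Ordinal (lt_hn _ (ltnW lt_s)))).
    by apply: T_col; rewrite //= -T_neq0 h_neq0 //= ltnW.
  move=> k; rewrite mem_entries sz_w; apply/idP/mapP.
    move=> /andP[k_n /eqP eq_k]; have [b [b_k _]] := T_uniq k k_n.
    have Tb_neq0 : T b != 0 :> nat by rewrite b_k -lt0n; case/andP: k_n.
    have := T_letter b Tb_neq0; rewrite b_k eq_k -eq_d => /val_inj b_c.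
    have b_rc : b = (b.1, c) by rewrite -b_c -surjective_pairing.
    exists (val b.1); last by rewrite fE -b_rc.
    by rewrite mem_iota add0n leq0n /= -h_neq0 -b_rc.
  move=> [s]; rewrite mem_iota add0n => /= lt_s ->.
  pose s' := Ordinal (lt_hn s lt_s); rewrite (fE s').
  have T_s : T (s', c) != 0 :> nat by rewrite h_neq0.
  rewrite lt0n T_s -ltnS ltn_ord /=; have := T_letter _ T_s; rewrite /= eq_d.
  by case: d {eq_d} (nth _ _ _) => -[].
have bal : ballot w.
  apply: ballot_entries => r lt_r.
  have r_n : r < n.
    rewrite (leq_trans lt_r) // -sz_w size_entries; exact: count_size.
  have [c1 eq_c1] : exists c : 'I_n, c = true :> nat.
    have := mem_nth 0 lt_r; rewrite mem_entries sz_w => /andP[k_n].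
    rewrite nth_mkseq; last by lia.
    by move=> /eqP/existsP[b /andP[/eqP b2 _]]; exists b.2.
  have c0_n : 0 < n by apply: leq_ltn_trans r_n.
  pose c0 := Ordinal c0_n; pose r' := Ordinal r_n.
  have T1 : T (r', c1) != 0 :> nat.
    by rewrite (T_column _ _ true) //= nth_entries_neq0 -size_entries.
  have T0 : T (r', c0) != 0 :> nat.
    by move: T1; rewrite !T_neq0 /in_diagram /=; apply: leq_ltn_trans.
  split.
    move: T0; rewrite (T_column _ _ false) //= nth_entries_neq0.
    by rewrite size_entries.
  rewrite -(T_column r' c1 true) // -(T_column r' c0 false) //.
  by apply: T_row; rewrite -?T_neq0 //= eq_c1.
exists w; first exact/ballotsP.
apply/ffunP => -[r c]; apply: val_inj => /=.
have [/ltn2_bool[d eq_d]|le_c] := ltnP c 2; last first.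
  by rewrite T_out // tableau_out.
by rewrite (T_column r c d) // (tableauE _ sz_w eq_d).
Qed.

Lemma SYT_cols2P n (T : filling n) :
  T \in SYT_cols n 2 <-> exists2 w, w \in ballots n & T = tableau n w.
Proof.
split=> [|[w /ballotsP[sz_w bal] ->]]; first exact: SYT_cols_tableau.
exact: tableau_SYT_cols.
Qed.

(** * Statistics of the tableau of a ballot word *)

Lemma nrows_tableau n w i :
    size w = n -> ballot w ->
  nrows i (tableau n w) =
  #|[set r : 'I_n | (r < count_mem false w) + (r < count_mem true w) == i]|.
Proof.
move=> sz_w bal; congr #|pred_of_set _|; apply/setP => r; rewrite !inE.
rewrite -nth_shape //; congr (_ == i).
transitivity #|[set c : 'I_n | 0 <= c < nth 0 (shape w) r]|.
  by congr #|pred_of_set _|; apply/setP => c; rewrite !inE tableau_neq0.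
rewrite card_ord_interval nth_shape //.
by have := ballot_le bal; have := count_memC w; lia.
Qed.

Lemma nrows1_tableau n w :
    size w = n -> ballot w ->
  nrows 1 (tableau n w) = count_mem false w - count_mem true w.
Proof.
move=> sz_w bal; rewrite nrows_tableau //.
transitivity #|[set r : 'I_n | count_mem true w <= r < count_mem false w]|.
  congr #|pred_of_set _|; apply/setP => r; rewrite !inE.
  by have := ballot_le bal; lia.
by rewrite card_ord_interval; have := count_memC w; lia.
Qed.

Lemma nrows2_tableau n w :
  size w = n -> ballot w -> nrows 2 (tableau n w) = count_mem true w.
Proof.
move=> sz_w bal; rewrite nrows_tableau //.
transitivity #|[set r : 'I_n | 0 <= r < count_mem true w]|.
  congr #|pred_of_set _|; apply/setP => r; rewrite !inE.
  by have := ballot_le bal; lia.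
by rewrite card_ord_interval; have := count_memC w; lia.
Qed.

Lemma col_size_restrict_tableau n w i (d : bool) :
    size w = n -> ballot w -> i <= n ->
  col_size d.+1 (restrict (tableau n w) i) = count_mem d (take i w).
Proof.
move=> sz_w bal le_i.
have le_n : count_mem d (take i w) <= n.
  by rewrite (leq_trans (count_size _ _)) // size_take_min sz_w geq_minr.
have boxE (r c : 'I_n) : ((r, c).2.+1 == d.+1) &&
      (restrict (tableau n w) i (r, c) != 0 :> nat) =
    (c == d :> nat) && (r < count_mem d (take i w)).
  rewrite eqSS /=; case: eqP => //= eq_d; rewrite ffunE.
  rewrite -nth_entries_leq ?sz_w // -(tableauE _ sz_w eq_d) size_entries.
  rewrite -nth_entries_neq0 -(tableauE _ sz_w eq_d).
  by case: leqP => _; rewrite ?andbT ?andbF.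
(* The grid has no column of index d when n = 0, or when n = 1 and d is true; in
   the latter case the ballot property makes the count vanish. *)
have [d_n|n_d] := ltnP d n.
  transitivity #|setX [set r : 'I_n | 0 <= r < count_mem d (take i w)]
                      [set Ordinal d_n]|.
    congr #|pred_of_set _|; apply/setP => -[r c].
    by rewrite !inE boxE andbC.
  by rewrite cardsX cards1 muln1 card_ord_interval; lia.
have -> : count_mem d (take i w) = 0.
  have := bal i; have := count_memC (take i w).
  rewrite size_take_min sz_w; case: (d) n_d => /=; lia.
apply/eqP; rewrite cards_eq0; apply/eqP/setP => -[r c]; rewrite !inE boxE.
by have := ltn_ord c; lia.
Qed.

(** The index of the entry i + 1 is defined by column sizes that include its own
    box, while [letter_weight] uses those before its insertion. *)
Lemma sigma_tableau n w i :
    size w = n -> ballot w -> i < n ->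
  sigma i.+1 (tableau n w) = letter_weight (take i w) (nth false w i).
Proof.
move=> sz_w bal lt_i; rewrite /sigma /letter_weight.
case: pickP => [b /eqP b_i|none]; last first.
  have [b [_ b_i]] := @tableau_box n w i.+1 sz_w bal lt_i.
  by have := none b; rewrite b_i eqxx.
have [-> _] := tableau_entry sz_w b_i (ltn0Sn i).
have take_i : take i.+1 w = rcons (take i w) (nth false w i).
  by rewrite (take_nth false) ?sz_w.
have := bal i.+1; have := count_memC (take i.+1 w).
have count_i d : count_mem d (take i.+1 w) =
    count_mem d (take i w) + (nth false w i == d).
  by rewrite take_i -cats1 count_cat /= addn0.
have sz_i : size (take i.+1 w) = i.+1 by rewrite size_take_min sz_w; lia.
have colE d := col_size_restrict_tableau d sz_w bal lt_i.
have col1 := colE false; have col2 := colE true.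
rewrite sz_i /= in col1 col2 count_i *.
case: (nth false w i) count_i => /= count_i;
  rewrite ?col1 ?col2 !count_i /=; lia.
Qed.

Lemma prod_sigma_tableau n w :
    size w = n -> ballot w ->
  \prod_(1 <= i < n.+1) sigma i (tableau n w) = word_weight w.
Proof.
move=> sz_w bal; rewrite big_add1 big_mkord /word_weight sz_w.
by apply: eq_bigr => i _; rewrite sigma_tableau.
Qed.

(** * The tableau expansion of the Andre polynomials *)

Theorem theorem32 (n : nat) (hn : (1 <= n)%N) :
  (andre_poly n.+1 =
   \sum_(T in SYT_cols n 2)
     (\prod_(1 <= i < n.+1) sigma i T)%N%:R
       * varx ^+ (n + 1 - nrows 1 T - nrows 2 T)%N
       * vary ^+ nrows 1 T)%R.
Proof.
pose F l u := (varx ^+ l * vary ^+ u)%R.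
have leavesE (w : seq bool) : size w = n -> ballot w ->
    n + 1 - (count_mem false w - count_mem true w) - count_mem true w =
    (count_mem true w).+1.
  by move=> sz_w /ballot_le; have := count_memC w; lia.
rewrite /andre_poly (sum_trees012 F n) -sum_ballots.
rewrite (sum_set_image _ (ballots_uniq n) (@tableau_inj n) (@SYT_cols2P n)).
apply: eq_big_seq => w /ballotsP[sz_w bal].
rewrite prod_sigma_tableau // nrows1_tableau // nrows2_tableau //.
by rewrite leavesE // -mulrA mulr_natl.
Qed.
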